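(* Suppose that $\underline{p}_u\le\bar{p}_u$ and $\underline{\chi}\le\bar{\chi}$ are such that, for all $\chi\in[\underline{\chi},\bar{\chi}]$, $[\underline{p}_u,\bar{p}_u]\subset(|\chi|\sqrt{R_sT},\,1/|\alpha|)$, and such that $p_v(p_u,\chi)\in(|\chi|\sqrt{R_sT},\,1/|\alpha|)$ for all $(p_u,\chi)\in[\underline{p}_u,\bar{p}_u]\times[\underline{\chi},\bar{\chi}]$. Let $\emptyset\ne[p_u^-,p_u^+]\times[\chi^-,\chi^+]\subseteq[\underline{p}_u,\bar{p}_u]\times[\underline{\chi},\bar{\chi}]$ be a given box. Then the derivative $\partial_{p_u}p_v(p_u,\chi)>0$ attains its maximum on the box $[p_u^-,p_u^+]\times[\chi^-,\chi^+]$ in $(p_u^-,\chi^+)$ if $\chi^+\ge0$, and in $(p_u^+,\chi^+)$ otherwise.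
   Context: Fix constants $R_s>0$, $T>0$, $\theta>0$, $\mathcal{L}>0$ (pipe length), and $\alpha<0$. For $\chi\in\mathbb{R}$ (mass flux) and $p\in(|\chi|\sqrt{R_sT},1/|\alpha|)$ let $$F(p)=F_\chi(p)=\frac1\alpha p+\left(\chi^2R_sT-\frac1{\alpha^2}\right)\ln(|1+\alpha p|)-\chi^2R_sT\ln(p),$$ which is strictly increasing in $p$ on this interval. The pressure function is $$p(x,p_u,\chi)=F_\chi^{-1}\left(F_\chi(p_u)-\tfrac12R_sT\,\chi|\chi|\,\theta x\right),\quad x\in[0,\mathcal{L}],$$ where $F_\chi^{-1}$ is the inverse of $F_\chi$ on $(|\chi|\sqrt{R_sT},1/|\alpha|)$, and the outlet pressure is $p_v(p_u,\chi)=p(\mathcal{L},p_u,\chi)$. The notation $\partial_{p_u}p_v$ is the partial derivative with respect to the first argument of $p_v$. *)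

(* Defs.v *)
From mathcomp Require Import all_boot all_order all_algebra.
From mathcomp Require Import all_classical all_reals all_analysis.
Import Order.TTheory GRing.Theory Num.Theory.
Import numFieldNormedType.Exports.

Set Implicit Arguments.
Unset Strict Implicit.
Unset Printing Implicit Defensive.

Local Open Scope classical_set_scope.
Local Open Scope ring_scope.

(* L : pipe length; chi : mass flux; pu : inlet pressure; Rs, T, theta and
   alpha : constants of the gas and of the pipe. *)

Definition pressure_dom {R : realType} (Rs T alpha chi : R) : set R :=
  `]`|chi| * Num.sqrt (Rs * T), `|alpha|^-1[%classic.

Definition Fchi {R : realType} (Rs T alpha chi p : R) : R :=
  alpha^-1 * p
  + (chi ^+ 2 * Rs * T - (alpha ^+ 2)^-1) * ln `|1 + alpha * p|
  - chi ^+ 2 * Rs * T * ln p.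

(* Total: outside the image of pressure_dom it takes the value 0, which is
   never in pressure_dom (see Finv_domP). *)
Definition Finv {R : realType} (Rs T alpha chi : R) : R -> R :=
  'pinv_(fun=> 0) (pressure_dom Rs T alpha chi) (Fchi Rs T alpha chi).

Lemma Finv_domP (R : realType) (Rs T alpha chi y : R) :
  pressure_dom Rs T alpha chi (Finv Rs T alpha chi y) <->
  (Fchi Rs T alpha chi @` pressure_dom Rs T alpha chi) y.
Proof.
set A := pressure_dom _ _ _ _; set f := Fchi _ _ _ _; split=> [|Fy]; last first.
  have Hs : set_surj A (f @` A) f by [].
  by apply: (@surjpinv_image_sub _ _ (fun=> 0) A (f @` A) f Hs); exists y.
apply: contraPP => nFy.
pose Hs : set_surj A (f @` A) f := fun _ => id.
rewrite /Finv /pinv_ splitV /=.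
rewrite [X in odflt _ X](_ : _ = None); last first.
  by rewrite -[LHS]/('oinv_(Hs) y) oinv_surj; case: pselect.
rewrite /A /pressure_dom /= in_itv /= => /andP[+ _].
by rewrite ltNge mulr_ge0 // sqrtr_ge0.
Qed.

Definition pressure {R : realType} (Rs T theta alpha x pu chi : R) : R :=
  Finv Rs T alpha chi
    (Fchi Rs T alpha chi pu - 2^-1 * Rs * T * (chi * `|chi|) * theta * x).

Definition outlet_pressure {R : realType}
    (Rs T theta L alpha pu chi : R) : R :=
  pressure Rs T theta alpha L pu chi.

Definition dpu_outlet_pressure {R : realType}
    (Rs T theta L alpha : R) (z : R * R) : R :=
  derive1 (fun pu => outlet_pressure Rs T theta L alpha pu z.2) z.1.

Definition box {R : realType} (a b c d : R) : set (R * R) :=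
  `[a, b] `*` `[c, d].

Definition attains_max_at {R : realType}
    (f : R * R -> R) (B : set (R * R)) (z : R * R) : Prop :=
  B z /\ forall w, B w -> f w <= f z.

(* Main.v *)
Require Import Defs.
From mathcomp Require Import all_boot all_order all_algebra.
From mathcomp Require Import all_classical all_reals all_analysis.
From mathcomp Require Import ring lra.
Import Order.TTheory GRing.Theory Num.Theory.
Import numFieldNormedType.Exports.
Local Open Scope classical_set_scope.
Local Open Scope ring_scope.

(** Write [k = chi^2 Rs T]. The derivative of F_chi is
    [(p^2 - k) / (p (1 + alpha p))], positive on the pressure interval, and the
    relation [F_chi pv = F_chi pu - friction] differentiates to
    [d pv / d pu = F'_chi pu / F'_chi pv > 0]. Everything follows from two
    monotonicity properties of this ratio.

    In the flux it is nondecreasing ([dpu_ndecr_chi]). Raising the flux lowers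
    the outlet pressure and so the denominator, because F' increases in [p];
    at fixed pressures the factor [(pu^2 - k) / (pv^2 - k)] moves the same way.
    Both facts follow from explicit comparisons: F_chi is affine in [k], so
    the implicit function [pv] need not be differentiated in [chi].

    In the inlet pressure the ratio has a derivative of the sign of
    [h pu - h pv], where [h = F'' / F'^2] decreases in [p] ([curvFchi_nincr]).
    Pressure falls along the flow, so [pv <= pu] for a nonnegative flux and
    [pu <= pv] for a nonpositive one: the ratio decreases in [pu] in the first
    case and increases in the second ([dpu_monotone_pu]).

    Moving a point of the box first to the edge of maximal flux and then along
    that edge, in the direction given by the sign of the maximal flux, only
    raises the derivative. *)

(** * The function F and its derivative on the pressure interval *)

(** The membership conditions in polynomial form, free of norms and square
    roots; every later sign argument uses them in this shape. *)
Lemma pressure_domP {R : realType} (Rs T alpha chi p : R) :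
  0 < Rs -> 0 < T -> alpha < 0 ->
  pressure_dom Rs T alpha chi p <->
  [/\ 0 < p, chi ^+ 2 * Rs * T < p ^+ 2 & 0 < 1 + alpha * p].
Proof.
move=> Rs0 T0 a0; rewrite /pressure_dom /= in_itv /=.
have RT0 : 0 <= Rs * T by rewrite mulr_ge0 // ltW.
have s0 : 0 <= `|chi| * Num.sqrt (Rs * T) by rewrite mulr_ge0 // sqrtr_ge0.
have sE : (`|chi| * Num.sqrt (Rs * T)) ^+ 2 = chi ^+ 2 * Rs * T.
  by rewrite exprMn real_normK ?num_real // sqr_sqrtr // mulrA.
have aE : (p < `|alpha|^-1) = (0 < 1 + alpha * p).
  rewrite ltr0_norm // -[ltRHS]mul1r ltr_pdivlMr ?oppr_gt0 //.
  by apply/idP/idP => h; lra.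
split=> [/andP[lo hi]|[p0 k hi]].
  have p0 : 0 < p by exact: le_lt_trans lo.
  by split; rewrite -?aE // -sE ltr_pXn2r ?nnegrE // ltW.
by rewrite aE hi andbT -(@ltr_pXn2r _ 2) ?nnegrE ?sE // ltW.
Qed.

Lemma flux_sqr_ge0 {R : realType} (Rs T chi : R) :
  0 < Rs -> 0 < T -> 0 <= chi ^+ 2 * Rs * T.
Proof. by move=> ? ?; rewrite -mulrA mulr_ge0 ?sqr_ge0 // ltW // mulr_gt0. Qed.

(** The derivative of [Fchi] in [p], see [is_derive_Fchi]; [k] stands for
    [chi ^+ 2 * Rs * T], the only way in which the flux enters. *)
Definition dFchi {R : realType} (alpha k p : R) : R :=
  (p ^+ 2 - k) / (p * (1 + alpha * p)).

(** The two logarithms and the linear term combine over the common denominator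
    [p * (1 + alpha * p)]: all terms but [p ^+ 2 - k] cancel. *)
Lemma is_derive_Fchi {R : realType} (Rs T alpha chi p : R) :
  0 < Rs -> 0 < T -> alpha < 0 -> pressure_dom Rs T alpha chi p ->
  is_derive p 1 (Fchi Rs T alpha chi) (dFchi alpha (chi ^+ 2 * Rs * T) p).
Proof.
move=> Rs0 T0 al0 /(pressure_domP _ _ _ _ _ Rs0 T0 al0)[p0 _ ap0].
have a0 : alpha != 0 by rewrite lt_eqF.
set k := chi ^+ 2 * Rs * T.
pose u : R -> R := cst 1 + alpha *: id.
have du : is_derive p 1 u alpha.
  have := is_deriveD (is_derive_cst (1 : R) p 1)
                     (is_deriveZ alpha (is_derive_id p 1)).
  by rewrite add0r /GRing.scale /= mulr1.
have dln : is_derive p 1 (@ln R \o u) ((1 + alpha * p)^-1 * alpha).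
  by apply: is_derive1_comp; apply: is_derive1_ln.
have dp : is_derive p 1 (@ln R) p^-1 by exact: is_derive1_ln.
pose f : R -> R :=
  alpha^-1 *: id + (k - (alpha ^+ 2)^-1) *: (@ln R \o u) - k *: @ln R.
apply: (@near_eq_is_derive _ _ _ f).
  have : \forall q \near p, 0 < u q.
    apply: (@cvgr_gt _ _ (nbhs p) _ u (u p)) => //.
    apply: differentiable_continuous.
    by apply/derivable1_diffP; case: du.
  by apply: filterS => q uq; rewrite /Fchi /f -/k gtr0_norm.
have df : is_derive p 1 f _ :=
  is_deriveB (is_deriveD _ (is_deriveZ _ dln)) (is_deriveZ k dp).
apply: is_derive_eq.
rewrite /dFchi /GRing.scale /=; field.
by rewrite (gt_eqF p0) (gt_eqF ap0) a0.
Qed.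

Lemma dFchi_gt0 {R : realType} (alpha k p : R) :
  0 < p -> k < p ^+ 2 -> 0 < 1 + alpha * p -> 0 < dFchi alpha k p.
Proof. by move=> p0 kp ap0; rewrite divr_gt0 ?mulr_gt0 // subr_gt0. Qed.

Lemma Fchi_lt {R : realType} (Rs T alpha chi p q : R) :
  0 < Rs -> 0 < T -> alpha < 0 ->
  pressure_dom Rs T alpha chi p -> pressure_dom Rs T alpha chi q ->
  p < q -> Fchi Rs T alpha chi p < Fchi Rs T alpha chi q.
Proof.
move=> Rs0 T0 a0 dp dq pq.
have dpq r : r \in `[p, q] -> pressure_dom Rs T alpha chi r.
  move: dp dq; rewrite /pressure_dom /= !in_itv /= => /andP[lo _] /andP[_ hi].
  by move=> /andP[pr rq]; rewrite (lt_le_trans lo pr) (le_lt_trans rq hi).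
have dF r (rpq : r \in `[p, q]) :=
  is_derive_Fchi _ _ _ _ _ Rs0 T0 a0 (dpq r rpq).
have sub r : r \in `]p, q[ -> r \in `[p, q].
  by rewrite !in_itv /= => /andP[/ltW -> /ltW ->].
have h := @gtr0_derive1_incr _ (Fchi Rs T alpha chi) p q.
have := h _ _ _ p q (lexx p) pq (lexx q); apply.
- by move=> r /sub/dF[].
- move=> r /sub rpq; rewrite derive1E; have [_ ->] := dF r rpq.
  have [r0 kr ar] := (pressure_domP _ _ _ _ _ Rs0 T0 a0).1 (dpq r rpq).
  exact: dFchi_gt0.
- by apply: derivable_within_continuous => r /dF[].
Qed.

Lemma FchiK {R : realType} (Rs T alpha chi : R) :
  0 < Rs -> 0 < T -> alpha < 0 ->
  {in pressure_dom Rs T alpha chi,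
    cancel (Fchi Rs T alpha chi) (Finv Rs T alpha chi)}.
Proof.
move=> Rs0 T0 a0; apply: pinvKV => p q /set_mem dp /set_mem dq Fpq.
by have [/(Fchi_lt _ _ _ _ _ _ Rs0 T0 a0 dp dq)
        |/(Fchi_lt _ _ _ _ _ _ Rs0 T0 a0 dq dp)|//] := ltgtP p q; rewrite Fpq ltxx.
Qed.

(** This rests on the outlet pressure lying in the domain: for total [Finv] that
    is what puts the argument of [Finv] into the image of [Fchi]. *)
Lemma Fchi_outlet {R : realType} (Rs T theta L alpha pu chi : R) :
  let pv := outlet_pressure Rs T theta L alpha pu chi in
  pressure_dom Rs T alpha chi pv ->
  Fchi Rs T alpha chi pv =
    Fchi Rs T alpha chi pu - 2^-1 * Rs * T * (chi * `|chi|) * theta * L.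
Proof.
by move=> pv /Finv_domP im; rewrite /pv /outlet_pressure /pressure pinvK ?inE.
Qed.

(** Differentiating [Fchi pv = Fchi pu - friction] in [pu] gives
    [dFchi pv * pv' = dFchi pu]. The derivative is two-sided even when [pu] is an
    end point of the given box, because the pressure interval is open. *)
Lemma is_derive_outlet {R : realType} (Rs T theta L alpha pu chi : R) :
  0 < Rs -> 0 < T -> alpha < 0 ->
  let pv p := outlet_pressure Rs T theta L alpha p chi in
  let k := chi ^+ 2 * Rs * T in
  pressure_dom Rs T alpha chi pu -> pressure_dom Rs T alpha chi (pv pu) ->
  is_derive pu 1 pv (dFchi alpha k pu / dFchi alpha k (pv pu)).
Proof.
move=> Rs0 T0 a0 pv k du dv; set q := pv pu in dv *.
set d := 2^-1 * Rs * T * (chi * `|chi|) * theta * L.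
have dF p := is_derive_Fchi _ _ _ chi p Rs0 T0 a0.
have dInv : is_derive (Fchi Rs T alpha chi q) 1
    (Finv Rs T alpha chi) (dFchi alpha k q)^-1.
  have nq : \near q, pressure_dom Rs T alpha chi q.
    by apply: open_nbhs_nbhs; split=> //; apply: itv_open.
  apply: is_derive_inverse.
  - by near=> r; apply: FchiK => //; rewrite inE; near: r.
  - near=> r; have dr : pressure_dom Rs T alpha chi r by near: r.
    by apply/differentiable_continuous/derivable1_diffP; case: (dF r dr).
  - exact: dF dv.
  - have [q0 kq aq] := (pressure_domP _ _ _ _ _ Rs0 T0 a0).1 dv.
    by rewrite gt_eqF // dFchi_gt0.
have dFd : is_derive pu 1 (Fchi Rs T alpha chi - cst d) (dFchi alpha k pu).
  by have := dF _ du => dFpu; apply: is_derive_eq; rewrite subr0.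
have FE : Fchi Rs T alpha chi q = (Fchi Rs T alpha chi - cst d) pu.
  exact: Fchi_outlet.
rewrite FE in dInv.
by rewrite mulrC; exact: (is_derive1_comp dInv dFd).
Unshelve. all: by end_near. Qed.

(** * Monotonicity of the derivative of F *)

(** This is F'' / F'^2, that is, the derivative of [- 1 / F'] in [p], or
    equivalently the derivative of [ln F'] with respect to the variable [F p].
    It is written as a sum of two terms that visibly decrease in [p]. *)
Definition curvFchi {R : realType} (alpha k p : R) : R :=
  (p ^+ 2 - k)^-1 + 2 * k * (1 + alpha * p) * (p ^+ 2 - k) ^- 2.

Lemma is_derive_dFchi {R : realType} (alpha k p : R) :
  0 < p -> k < p ^+ 2 -> 0 < 1 + alpha * p ->
  is_derive p 1 (dFchi alpha k) (curvFchi alpha k p * dFchi alpha k p ^+ 2).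
Proof.
move=> p0 kp ap0.
pose n : R -> R := id * id - cst k.
pose m : R -> R := id + alpha *: (id * id).
have id1 := is_derive_id p (1 : R).
have idid := is_deriveM id1 id1.
have dn := is_deriveB idid (is_derive_cst k p (1 : R)).
have dm := is_deriveD id1 (is_deriveZ alpha idid).
have mE q : m q = q * (1 + alpha * q).
  by rewrite (_ : m q = q + alpha * (q * q)) //; ring.
have m0 : m p != 0 by rewrite mE gt_eqF // mulr_gt0.
have dmV := is_deriveV m0 dm.
have dnm := is_deriveM dn dmV.
have fE : n * (fun q => (m q)^-1) = dFchi alpha k.
  by apply/funext => q; rewrite /dFchi -mE expr2.
rewrite [X in is_derive _ _ X _]fE in dnm.
apply: (is_derive_eq dnm).
rewrite (_ : (id * id - cst k) p = p * p - k) // mE.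
rewrite /curvFchi /dFchi /GRing.scale /=; field.
by rewrite (gt_eqF p0) (gt_eqF ap0) subr_eq0 gt_eqF.
Qed.

(** F' is log-concave as a function of [F p]. *)
Lemma curvFchi_nincr {R : realType} (alpha k p q : R) :
  alpha < 0 -> 0 <= k -> 0 < p -> k < p ^+ 2 -> p <= q -> 0 < 1 + alpha * q ->
  curvFchi alpha k q <= curvFchi alpha k p.
Proof.
move=> a0 k0 p0 kp pq aq0.
have pq2 : p ^+ 2 <= q ^+ 2 by rewrite lerXn2r ?nnegrE ?(le_trans (ltW p0)) // ltW.
have p2 : 0 < p ^+ 2 - k by rewrite subr_gt0.
have q2 : 0 < q ^+ 2 - k by rewrite subr_gt0 (lt_le_trans kp).
have pq2k : p ^+ 2 - k <= q ^+ 2 - k by rewrite lerB.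
have apq : 1 + alpha * q <= 1 + alpha * p by rewrite lerD2l ler_wnM2l // ltW.
rewrite lerD ?lef_pV2 // ler_pM ?mulr_ge0 ?invr_ge0 ?sqr_ge0 //; first exact: ltW.
  by rewrite ler_wpM2l // mulr_ge0.
by rewrite lef_pV2 ?posrE ?exprn_gt0 // lerXn2r // nnegrE ltW.
Qed.

(** After cancelling a factor [p], the numerator [p - k / p] increases and the
    denominator [1 + alpha * p] decreases. *)
Lemma dFchi_ndecr {R : realType} (alpha k p q : R) :
  alpha < 0 -> 0 <= k -> 0 < p -> k < p ^+ 2 -> p <= q -> 0 < 1 + alpha * q ->
  dFchi alpha k p <= dFchi alpha k q.
Proof.
move=> a0 k0 p0 kp pq aq0.
have q0 : 0 < q by exact: lt_le_trans pq.
have apq : 1 + alpha * q <= 1 + alpha * p by rewrite lerD2l ler_wnM2l // ltW.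
have ap0 : 0 < 1 + alpha * p by exact: lt_le_trans apq.
have dE r : 0 < r -> 0 < 1 + alpha * r ->
    dFchi alpha k r = (r - k / r) / (1 + alpha * r).
  by move=> r0 ar0; rewrite /dFchi; field; rewrite (gt_eqF r0) gt_eqF.
rewrite !dE // ler_pM ?invr_ge0 ?(ltW ap0) //.
- by rewrite subr_ge0 ler_pdivrMr // -expr2 ltW.
- by rewrite lerB // ler_wpM2l // lef_pV2.
- by rewrite lef_pV2.
Qed.

(** The ratio depends on [k] only through
    [(p ^+ 2 - k) / (q ^+ 2 - k) = 1 + (p ^+ 2 - q ^+ 2) / (q ^+ 2 - k)]. *)
Lemma dFchi_ratio_ndecr {R : realType} (alpha k1 k2 p q : R) :
  0 < q -> q <= p -> k1 <= k2 -> k2 < q ^+ 2 ->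
  0 < 1 + alpha * q -> 0 < 1 + alpha * p ->
  dFchi alpha k1 p / dFchi alpha k1 q <= dFchi alpha k2 p / dFchi alpha k2 q.
Proof.
move=> q0 qp k12 k2q aq ap.
have p0 : 0 < p by exact: lt_le_trans qp.
have k1q := le_lt_trans k12 k2q.
have pq2 : q ^+ 2 <= p ^+ 2 by rewrite lerXn2r ?nnegrE ?(ltW p0) ?(ltW q0).
have rE k : k < q ^+ 2 -> dFchi alpha k p / dFchi alpha k q =
    (1 + (p ^+ 2 - q ^+ 2) / (q ^+ 2 - k)) *
    (q * (1 + alpha * q) / (p * (1 + alpha * p))).
  move=> kq; rewrite /dFchi; field.
  by rewrite (gt_eqF p0) (gt_eqF q0) (gt_eqF ap) (gt_eqF aq) subr_eq0 gt_eqF.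
rewrite !rE // ler_wpM2r //.
  by rewrite divr_ge0 // mulr_ge0 // ltW.
rewrite lerD2l ler_wpM2l ?subr_ge0 // lef_pV2 ?posrE ?subr_gt0 //.
by rewrite lerB.
Qed.

(** The reciprocal of the ratio in [dFchi_ratio_ndecr], with the roles of the two
    pressures exchanged. *)
Lemma dFchi_ratio_nincr {R : realType} (alpha k1 k2 p q : R) :
  0 < p -> p <= q -> k1 <= k2 -> k2 < p ^+ 2 ->
  0 < 1 + alpha * q -> 0 < 1 + alpha * p ->
  dFchi alpha k2 p / dFchi alpha k2 q <= dFchi alpha k1 p / dFchi alpha k1 q.
Proof.
move=> p0 pq k12 k2p aq ap.
have q0 := lt_le_trans p0 pq.
have pq2 : p ^+ 2 <= q ^+ 2 by rewrite lerXn2r ?nnegrE ?(ltW p0) ?(ltW q0).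
have pos k r : k <= k2 -> p <= r -> 0 < 1 + alpha * r -> 0 < dFchi alpha k r.
  move=> kk2 pr ar; have r0 := lt_le_trans p0 pr.
  apply: dFchi_gt0 => //; apply: (le_lt_trans kk2); apply: lt_le_trans k2p _.
  by rewrite lerXn2r ?nnegrE ?(ltW p0) ?(ltW r0).
rewrite -[leLHS]invf_div -[leRHS]invf_div lef_pV2 ?posrE.
- exact: dFchi_ratio_ndecr.
- by apply: divr_gt0; apply: pos.
- by apply: divr_gt0; apply: pos.
Qed.

(** [Fchi] is affine in [k = chi ^+ 2 * Rs * T], and the coefficient of [k] is
    [ln (1 + alpha * p) - ln p], which decreases in [p]. *)
Lemma Fchi_diff_nincr {R : realType} (Rs T alpha chi1 chi2 p q : R) :
  let k chi := chi ^+ 2 * Rs * T in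
  0 < p -> p <= q -> alpha < 0 -> 0 < 1 + alpha * q -> k chi1 <= k chi2 ->
  Fchi Rs T alpha chi2 q - Fchi Rs T alpha chi2 p <=
  Fchi Rs T alpha chi1 q - Fchi Rs T alpha chi1 p.
Proof.
move=> k p0 pq a0 aq0 k12.
have apq : 1 + alpha * q <= 1 + alpha * p by rewrite lerD2l ler_wnM2l // ltW.
have ap0 : 0 < 1 + alpha * p by exact: lt_le_trans apq.
have q0 := lt_le_trans p0 pq.
have l1 : ln (1 + alpha * q) <= ln (1 + alpha * p) by rewrite ler_ln.
have l2 : ln p <= ln q by rewrite ler_ln.
rewrite -subr_ge0 /Fchi !gtr0_norm // -/(k chi1) -/(k chi2).
rewrite (_ : _ - _ = (k chi2 - k chi1) *
  ((ln (1 + alpha * p) - ln (1 + alpha * q)) + (ln q - ln p))); last by ring.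
by apply: mulr_ge0; [|apply: addr_ge0]; rewrite subr_ge0.
Qed.

(** * Monotonicity of the outlet pressure and of its derivative *)

Lemma Fchi_le_inv {R : realType} (Rs T alpha chi p q : R) :
  0 < Rs -> 0 < T -> alpha < 0 ->
  pressure_dom Rs T alpha chi p -> pressure_dom Rs T alpha chi q ->
  Fchi Rs T alpha chi p <= Fchi Rs T alpha chi q -> p <= q.
Proof.
move=> Rs0 T0 a0 dp dq Fpq; rewrite leNgt; apply/negP => qp.
by have := Fchi_lt _ _ _ _ _ _ Rs0 T0 a0 dq dp qp; rewrite ltNge Fpq.
Qed.

Lemma friction_ndecr {R : realType} (Rs T theta L chi1 chi2 : R) :
  0 < Rs -> 0 < T -> 0 < theta -> 0 < L -> chi1 <= chi2 ->
  2^-1 * Rs * T * (chi1 * `|chi1|) * theta * L <=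
  2^-1 * Rs * T * (chi2 * `|chi2|) * theta * L.
Proof.
move=> Rs0 T0 th0 L0 c12.
have c0 : 0 <= 2^-1 * Rs * T by rewrite !mulr_ge0 ?invr_ge0 // ltW.
rewrite !ler_wpM2r ?ler_wpM2l ?(ltW th0) ?(ltW L0) //.
have [c10|c10] := leP 0 chi1.
  by rewrite !ger0_norm ?(le_trans c10) // ler_pM.
rewrite (ltr0_norm c10).
have [c20|c20] := leP 0 chi2.
  by rewrite ger0_norm //; nra.
by rewrite ltr0_norm //; nra.
Qed.

Lemma outlet_le_inlet {R : realType} (Rs T theta L alpha pu chi : R) :
  0 < Rs -> 0 < T -> 0 < theta -> 0 < L -> alpha < 0 ->
  let pv := outlet_pressure Rs T theta L alpha pu chi in
  pressure_dom Rs T alpha chi pu -> pressure_dom Rs T alpha chi pv ->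
  0 <= chi -> pv <= pu.
Proof.
move=> Rs0 T0 th0 L0 a0 pv du dv chi0.
apply: (Fchi_le_inv _ _ _ _ _ _ Rs0 T0 a0 dv du); rewrite Fchi_outlet //.
rewrite gerBl; have := friction_ndecr _ _ _ _ _ _ Rs0 T0 th0 L0 chi0.
by rewrite mul0r mulr0 !mul0r.
Qed.

Lemma inlet_le_outlet {R : realType} (Rs T theta L alpha pu chi : R) :
  0 < Rs -> 0 < T -> 0 < theta -> 0 < L -> alpha < 0 ->
  let pv := outlet_pressure Rs T theta L alpha pu chi in
  pressure_dom Rs T alpha chi pu -> pressure_dom Rs T alpha chi pv ->
  chi <= 0 -> pu <= pv.
Proof.
move=> Rs0 T0 th0 L0 a0 pv du dv chi0.
apply: (Fchi_le_inv _ _ _ _ _ _ Rs0 T0 a0 du dv); rewrite Fchi_outlet //.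
rewrite lerBrDr gerDl.
have := friction_ndecr _ _ _ _ _ _ Rs0 T0 th0 L0 chi0.
by rewrite mul0r mulr0 !mul0r.
Qed.

Lemma dpuE {R : realType} (Rs T theta L alpha pu chi : R) :
  0 < Rs -> 0 < T -> alpha < 0 ->
  let pv := outlet_pressure Rs T theta L alpha pu chi in
  let k := chi ^+ 2 * Rs * T in
  pressure_dom Rs T alpha chi pu -> pressure_dom Rs T alpha chi pv ->
  dpu_outlet_pressure Rs T theta L alpha (pu, chi) =
  dFchi alpha k pu / dFchi alpha k pv.
Proof.
move=> Rs0 T0 a0 pv k du dv; rewrite /dpu_outlet_pressure derive1E /=.
by have [_ ->] := is_derive_outlet _ _ _ _ _ _ _ Rs0 T0 a0 du dv.
Qed.

(** The derivative is [dFchi pu / dFchi pv]. When both fluxes have the same sign,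
    a larger flux lowers the outlet pressure, hence the denominator, and the
    change of [k] at fixed pressures raises the ratio as well. Fluxes of opposite
    signs are separated by the value 1, since pressure falls along the flow. *)
Lemma dpu_ndecr_chi {R : realType} (Rs T theta L alpha pu chi1 chi2 : R) :
  0 < Rs -> 0 < T -> 0 < theta -> 0 < L -> alpha < 0 ->
  let pv := outlet_pressure Rs T theta L alpha pu in
  pressure_dom Rs T alpha chi1 pu -> pressure_dom Rs T alpha chi1 (pv chi1) ->
  pressure_dom Rs T alpha chi2 pu -> pressure_dom Rs T alpha chi2 (pv chi2) ->
  chi1 <= chi2 ->
  dpu_outlet_pressure Rs T theta L alpha (pu, chi1) <=
  dpu_outlet_pressure Rs T theta L alpha (pu, chi2).
Proof.
move=> Rs0 T0 th0 L0 a0 pv du1 dv1 du2 dv2 c12.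
rewrite !dpuE // -/(pv chi1) -/(pv chi2).
have domP chi p := pressure_domP Rs T alpha chi p Rs0 T0 a0.
have [u0 k1u au] := (domP _ _).1 du1; have [_ k2u _] := (domP _ _).1 du2.
have [v10 k1v av1] := (domP _ _).1 dv1; have [v20 k2v av2] := (domP _ _).1 dv2.
have F1 := Fchi_outlet _ _ _ _ _ _ _ dv1; have F2 := Fchi_outlet _ _ _ _ _ _ _ dv2.
have d12 := friction_ndecr _ _ _ _ _ _ Rs0 T0 th0 L0 c12.
have kge0 chi := flux_sqr_ge0 Rs T chi Rs0 T0.
have kle chi chi' : chi ^+ 2 <= chi' ^+ 2 -> chi ^+ 2 * Rs * T <= chi' ^+ 2 * Rs * T.
  by move=> h; rewrite !ler_wpM2r // ltW.
have [c1|/ltW c1] := leP 0 chi1.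
  have c2 := le_trans c1 c12.
  have k12 : chi1 ^+ 2 * Rs * T <= chi2 ^+ 2 * Rs * T.
    by rewrite kle // lerXn2r ?nnegrE.
  have v2u := outlet_le_inlet _ _ _ _ _ _ _ Rs0 T0 th0 L0 a0 du2 dv2 c2.
  have k1v2 := le_lt_trans k12 k2v.
  (* The outlet pressures are compared through F at the flux of smaller modulus,
     whose pressure interval contains both of them. *)
  have v21 : pv chi2 <= pv chi1.
    apply: (Fchi_le_inv _ _ _ chi1 _ _ Rs0 T0 a0) => //; first exact/domP.
    have := Fchi_diff_nincr Rs T alpha chi1 chi2 _ _ v20 v2u a0 au k12.
    by rewrite /pv F1 F2; lra.
  apply: (@le_trans _ _ (dFchi alpha (chi1 ^+ 2 * Rs * T) pu /
                         dFchi alpha (chi1 ^+ 2 * Rs * T) (pv chi2))).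
    rewrite ler_wpM2l ?(ltW (dFchi_gt0 _ _ _ _ _ _)) //.
    by rewrite lef_pV2 ?posrE ?dFchi_gt0 // dFchi_ndecr.
  exact: dFchi_ratio_ndecr.
have u1v := inlet_le_outlet _ _ _ _ _ _ _ Rs0 T0 th0 L0 a0 du1 dv1 c1.
have [c2|/ltW c2] := leP 0 chi2.
  have v2u := outlet_le_inlet _ _ _ _ _ _ _ Rs0 T0 th0 L0 a0 du2 dv2 c2.
  apply: (@le_trans _ _ 1).
    by rewrite ler_pdivrMr ?dFchi_gt0 // mul1r dFchi_ndecr.
  by rewrite ler_pdivlMr ?dFchi_gt0 // mul1r dFchi_ndecr.
have k21 : chi2 ^+ 2 * Rs * T <= chi1 ^+ 2 * Rs * T.
  by rewrite kle // -[leLHS]sqrrN -[leRHS]sqrrN lerXn2r ?nnegrE ?oppr_ge0 // lerN2.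
have k2v1 := le_lt_trans k21 k1v.
have v21 : pv chi2 <= pv chi1.
  apply: (Fchi_le_inv _ _ _ chi2 _ _ Rs0 T0 a0) => //; first exact/domP.
  have := Fchi_diff_nincr Rs T alpha chi2 chi1 _ _ u0 u1v a0 av1 k21.
  by rewrite /pv F1 F2; lra.
apply: (@le_trans _ _ (dFchi alpha (chi2 ^+ 2 * Rs * T) pu /
                       dFchi alpha (chi2 ^+ 2 * Rs * T) (pv chi1))).
  exact: dFchi_ratio_nincr.
rewrite ler_wpM2l ?(ltW (dFchi_gt0 _ _ _ _ _ _)) //.
by rewrite lef_pV2 ?posrE ?dFchi_gt0 // dFchi_ndecr.
Qed.

(** With [g = dFchi] and [h = curvFchi], [g' = h * g ^+ 2] and
    [pv' = g pu / g pv], so the quotient rule makes the derivative of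
    [g pu / g pv] a positive multiple of [h pu - h pv]. *)
Lemma is_derive_dFchi_ratio {R : realType} (Rs T theta L alpha pu chi : R) :
  0 < Rs -> 0 < T -> alpha < 0 ->
  let pv p := outlet_pressure Rs T theta L alpha p chi in
  let k := chi ^+ 2 * Rs * T in
  pressure_dom Rs T alpha chi pu -> pressure_dom Rs T alpha chi (pv pu) ->
  is_derive pu 1 (fun p => dFchi alpha k p / dFchi alpha k (pv p))
    (dFchi alpha k pu ^+ 2 / dFchi alpha k (pv pu) *
     (curvFchi alpha k pu - curvFchi alpha k (pv pu))).
Proof.
move=> Rs0 T0 a0 pv k du dv.
have [u0 ku au] := (pressure_domP _ _ _ _ _ Rs0 T0 a0).1 du.
have [v0 kv av] := (pressure_domP _ _ _ _ _ Rs0 T0 a0).1 dv.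
have dnum := is_derive_dFchi _ _ _ u0 ku au.
have dpv := is_derive_outlet _ _ _ _ _ _ _ Rs0 T0 a0 du dv.
have dden := is_derive1_comp (is_derive_dFchi _ _ _ v0 kv av) dpv.
have v_neq0 : dFchi alpha k (pv pu) != 0 by rewrite gt_eqF ?dFchi_gt0.
have dratio := is_deriveM dnum (is_deriveV (f := dFchi alpha k \o pv) v_neq0 dden).
apply: (is_derive_eq dratio); rewrite /GRing.scale /= -/(pv pu) -/k.
by field.
Qed.

(** The sign of [curvFchi pu - curvFchi pv] is decided by the order of inlet and
    outlet pressure, that is, by the direction of the flow. The mean value
    argument is run on the ratio of [dFchi], which is known to equal the derivative of
    the outlet pressure only on [a, b]. *)
Lemma dpu_monotone_pu {R : realType} (Rs T theta L alpha chi a b : R) :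
  0 < Rs -> 0 < T -> 0 < theta -> 0 < L -> alpha < 0 ->
  let pv p := outlet_pressure Rs T theta L alpha p chi in
  let dpu p := dpu_outlet_pressure Rs T theta L alpha (p, chi) in
  (forall p, p \in `[a, b] ->
     pressure_dom Rs T alpha chi p /\ pressure_dom Rs T alpha chi (pv p)) ->
  a <= b -> (0 <= chi -> dpu b <= dpu a) /\ (chi <= 0 -> dpu a <= dpu b).
Proof.
move=> Rs0 T0 th0 L0 a0 pv dpu dom ab.
have domP p := pressure_domP Rs T alpha chi p Rs0 T0 a0.
have k0 := flux_sqr_ge0 Rs T chi Rs0 T0.
have aab : a \in `[a, b] by rewrite in_itv /= lexx.
have bab : b \in `[a, b] by rewrite in_itv /= lexx andbT.
have [[da dva] [db dvb]] := (dom a aab, dom b bab).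
rewrite /dpu !dpuE //.
set k := chi ^+ 2 * Rs * T in k0 *.
pose ratio p := dFchi alpha k p / dFchi alpha k (pv p).
have dratio p (pab : p \in `[a, b]) :=
  is_derive_dFchi_ratio _ _ _ _ _ _ _ Rs0 T0 a0 (dom p pab).1 (dom p pab).2.
have sub p : p \in `]a, b[ -> p \in `[a, b].
  by rewrite !in_itv /= => /andP[/ltW -> /ltW ->].
have derivable_ratio p : p \in `]a, b[ -> derivable ratio p 1.
  by move=> /sub/dratio[].
have continuous_ratio : {within `[a, b], continuous ratio}.
  by apply: derivable_within_continuous => p /dratio[].
have factor_ge0 p : p \in `[a, b] ->
    0 <= dFchi alpha k p ^+ 2 / dFchi alpha k (pv p).
  move=> /dom[_ /domP[v0 kv av]].
  by rewrite divr_ge0 ?sqr_ge0 // ltW // dFchi_gt0.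
split=> chi0.
- have decr := @ler0_derive1_nincr _ ratio a b derivable_ratio.
  have := decr _ continuous_ratio a b (lexx a) ab (lexx b); apply.
  move=> p /sub pab; rewrite derive1E; have [_ ->] := dratio p pab.
  have [dp dv] := dom p pab.
  have [p0 kp ap] := (domP _).1 dp; have [v0 kv av] := (domP _).1 dv.
  have vp := outlet_le_inlet _ _ _ _ _ _ _ Rs0 T0 th0 L0 a0 dp dv chi0.
  by rewrite mulr_ge0_le0 ?factor_ge0 // subr_le0 curvFchi_nincr.
- have incr := @ger0_derive1_ndecr _ ratio a b derivable_ratio.
  have := incr _ continuous_ratio a b (lexx a) ab (lexx b); apply.
  move=> p /sub pab; rewrite derive1E; have [_ ->] := dratio p pab.
  have [dp dv] := dom p pab.
  have [p0 kp ap] := (domP _).1 dp; have [v0 kv av] := (domP _).1 dv.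
  have pv_ge := inlet_le_outlet _ _ _ _ _ _ _ Rs0 T0 th0 L0 a0 dp dv chi0.
  by rewrite mulr_ge0 ?factor_ge0 // subr_ge0 curvFchi_nincr.
Qed.

(** * Location of the maximum *)

Theorem theorem5p4 (R : realType) (Rs T theta L alpha : R)
    (Rs_gt0 : 0 < Rs) (T_gt0 : 0 < T) (theta_gt0 : 0 < theta) (L_gt0 : 0 < L)
    (alpha_lt0 : alpha < 0)
    (pu_lo pu_hi chi_lo chi_hi : R)
    (pu_lo_hi : pu_lo <= pu_hi) (chi_lo_hi : chi_lo <= chi_hi)
    (pu_dom : forall chi, chi_lo <= chi <= chi_hi ->
      `[pu_lo, pu_hi]%classic `<=` pressure_dom Rs T alpha chi)
    (pv_dom : forall pu chi, box pu_lo pu_hi chi_lo chi_hi (pu, chi) ->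
      pressure_dom Rs T alpha chi (outlet_pressure Rs T theta L alpha pu chi))
    (pum pup chim chip : R)
    (box_neq0 : box pum pup chim chip !=set0)
    (box_sub : box pum pup chim chip `<=` box pu_lo pu_hi chi_lo chi_hi) :
  (forall pu chi, box pum pup chim chip (pu, chi) ->
     derivable (fun p : R => outlet_pressure Rs T theta L alpha p chi) pu 1 /\
     0 < dpu_outlet_pressure Rs T theta L alpha (pu, chi)) /\
  (0 <= chip ->
     attains_max_at (dpu_outlet_pressure Rs T theta L alpha)
       (box pum pup chim chip) (pum, chip)) /\
  (chip < 0 ->
     attains_max_at (dpu_outlet_pressure Rs T theta L alpha)
       (box pum pup chim chip) (pup, chip)).
Proof.
have boxP a b c d p x : box a b c d (p, x) <-> (a <= p <= b) /\ (c <= x <= d).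
  by rewrite /box /=; split=> -[]; rewrite !in_itv.
have [[p0 x0] /boxP[/andP[h1 h2] /andP[h3 h4]]] := box_neq0.
have pump := le_trans h1 h2; have chimp := le_trans h3 h4.
have domu pu chi : box pum pup chim chip (pu, chi) ->
    pressure_dom Rs T alpha chi pu /\
    pressure_dom Rs T alpha chi (outlet_pressure Rs T theta L alpha pu chi).
  move=> /box_sub Hbox; split; last exact: pv_dom.
  have /boxP[Hpu Hchi] := Hbox.
  by apply: (pu_dom chi Hchi); rewrite /= in_itv.
have domP chi p := pressure_domP Rs T alpha chi p Rs_gt0 T_gt0 alpha_lt0.
have incr_chi pu chi : box pum pup chim chip (pu, chi) ->
    dpu_outlet_pressure Rs T theta L alpha (pu, chi) <=
    dpu_outlet_pressure Rs T theta L alpha (pu, chip).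
  move=> Hbox; have /boxP[Hpu /andP[cl ch]] := Hbox.
  have [du dv] := domu _ _ Hbox.
  have [|du' dv'] := domu pu chip; first by apply/boxP; rewrite lexx andbT.
  exact: dpu_ndecr_chi.
have domp a b : pum <= a -> b <= pup -> forall p, p \in `[a, b] ->
    pressure_dom Rs T alpha chip p /\
    pressure_dom Rs T alpha chip (outlet_pressure Rs T theta L alpha p chip).
  move=> pa bp p; rewrite in_itv /= => /andP[ap pb]; apply: domu; apply/boxP.
  by rewrite (le_trans pa ap) (le_trans pb bp) lexx chimp.
split; [|split].
- move=> pu chi /domu[du dv].
  have [u0 ku au] := (domP _ _).1 du; have [v0 kv av] := (domP _ _).1 dv.
  split.
    by have [] := is_derive_outlet _ _ _ _ _ _ _ Rs_gt0 T_gt0 alpha_lt0 du dv.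
  by rewrite dpuE // divr_gt0 // dFchi_gt0.
- move=> chip0; split; first by apply/boxP; rewrite !lexx pump chimp.
  move=> [pu chi] Hbox; apply: (le_trans (incr_chi _ _ Hbox)).
  have /boxP[/andP[pl ph] _] := Hbox.
  have [] // := dpu_monotone_pu Rs T theta L alpha chip pum pu; first exact: domp.
  by move=> decr _; exact: decr.
- move=> /ltW chip0; split; first by apply/boxP; rewrite !lexx pump chimp.
  move=> [pu chi] Hbox; apply: (le_trans (incr_chi _ _ Hbox)).
  have /boxP[/andP[pl ph] _] := Hbox.
  have [] // := dpu_monotone_pu Rs T theta L alpha chip pu pup; first exact: domp.
  by move=> _ incr; exact: incr.
Qed.
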